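(* Let $\beta,\gamma,m$ be constants, let $\Delta t,\Delta r>0$, and consider the finite-difference scheme $$\frac{v_j^{n+1}-2v_j^n+v_j^{n-1}}{(\Delta t)^2}-\frac{\delta_0^2v_j^n}{(\Delta r)^2}+\gamma\frac{v_j^{n+1}-v_j^{n-1}}{2\Delta t}-\beta\frac{\delta_0^2v_j^{n+1}-\delta_0^2v_j^{n-1}}{2\Delta t(\Delta r)^2}+\frac{m^2}{2}\bigl[v_j^{n+1}+v_j^{n-1}\bigr]=0,$$ where $\delta_0^2v_j^n=v_{j+1}^n-2v_j^n+v_{j-1}^n$ and $v_j^n$ approximates $v(j\Delta r,n\Delta t)$. This scheme is consistent of order $\mathcal{O}(\Delta t^2)+\mathcal{O}(\Delta r^2)$ with the equation $$\frac{\partial^2v}{\partial t^2}-\frac{\partial^2v}{\partial r^2}+\gamma\frac{\partial v}{\partial t}-\beta\frac{\partial^3v}{\partial t\,\partial r^2}+m^2v=0.$$ Moreover, in order for the scheme to be stable of order $n$ it is necessary that $$\left(\frac{\Delta t}{\Delta r}\right)^2<1+\gamma\frac{\Delta t}{4}+\beta\frac{\Delta t}{(\Delta r)^2}+m^2\frac{(\Delta t)^2}{4}.$$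
   Context: The equation arises from the damped Klein-Gordon equation $w_{tt}-\nabla^2w-\beta\,\partial_t(\nabla^2w)+\gamma w_t+m^2w=0$ (the case of zero nonlinear term) for radially symmetric $w(r,t)$ in a sphere of radius $L$ about the origin in $\mathbb{R}^3$, by setting $v(r,t)=r\,w(r,t)$; here $0<r<L$, $v(0,t)=0$, and $v(r,0)$ and $\partial v/\partial t(r,0)$ are prescribed. The constants $\beta$ and $\gamma$ are the internal and external damping coefficients. Put $R=\Delta t/\Delta r$ and $$\hat k(\xi)=1+\gamma\frac{\Delta t}{2}+2\frac{\beta\Delta t}{(\Delta r)^2}\sin^2\frac{\xi}{2}+m^2\frac{(\Delta t)^2}{2},\qquad \hat h(\xi)=1-\gamma\frac{\Delta t}{2}-2\frac{\beta\Delta t}{(\Delta r)^2}\sin^2\frac{\xi}{2}+m^2\frac{(\Delta t)^2}{2}.$$ Writing the scheme as a two-level system for the vectors with components $v_j^{n+1}$ and $v_j^n$ and taking the Fourier transform, one step of the scheme is multiplication by the amplification matrix $$A(\xi)=\begin{pmatrix}\dfrac{2}{\hat k(\xi)}\Bigl(1-2R^2\sin^2\dfrac{\xi}{2}\Bigr)&-\dfrac{\hat h(\xi)}{\hat k(\xi)}\\[2mm]1&0\end{pmatrix}.$$ Stability of order $n$ means that the powers of the amplification matrix grow at most linearly: there are constants $K_1,K_2$ with $\|A(\xi)^n\|\le K_1+nK_2$ for all $n\in\mathbb{N}$ and all $\xi$. The displayed necessary condition is the same as $1-2R^2>-\hat k(\pi)$.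
   Formalization: The strict inequality fails for β=γ=m=0, Δt=Δr (stable of order n, yet equality); proved instead: ≤ always, and the strict < whenever γ+4β/(Δr)²≠0. It is also assumed that k̂(ξ) never vanishes, so that A(ξ) is defined. *)

(* Defs.v *)
(* Stdlib reals with Coquelicot. *)
From Stdlib Require Import Reals ZArith Lra.
From Coquelicot Require Import Coquelicot.
Open Scope R_scope.

(* A grid function is v : Z -> Z -> R, with v j n standing for v_j^n. *)

Definition delta02 (v : Z -> Z -> R) (j n : Z) : R :=
  v (j + 1)%Z n - 2 * v j n + v (j - 1)%Z n.

Definition scheme (beta gamma m dt dr : R) (v : Z -> Z -> R) (j n : Z) : R :=
  (v j (n + 1)%Z - 2 * v j n + v j (n - 1)%Z) / dt ^ 2
  - delta02 v j n / dr ^ 2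
  + gamma * ((v j (n + 1)%Z - v j (n - 1)%Z) / (2 * dt))
  - beta * ((delta02 v j (n + 1)%Z - delta02 v j (n - 1)%Z)
            / (2 * dt * dr ^ 2))
  + m ^ 2 / 2 * (v j (n + 1)%Z + v j (n - 1)%Z).

Definition sample (dt dr : R) (v : R -> R -> R) (j n : Z) : R :=
  v (IZR j * dr) (IZR n * dt).

Definition kg_op (beta gamma m : R) (v : R -> R -> R) (r t : R) : R :=
  Derive_n (fun s => v r s) 2 t
  - Derive_n (fun x => v x t) 2 r
  + gamma * Derive (fun s => v r s) t
  - beta * Derive (fun s => Derive_n (fun x => v x s) 2 r) t
  + m ^ 2 * v r t.

(* The truncation error [scheme - kg_op] of every function v of class C^5 on an
   open set U (for instance 0 < r < L, 0 < t) is O(dt^2) + O(dr^2), uniformly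
   over all grid points whose stencil lies in a given compact rectangle of U.
   Five is the order of the highest derivatives occurring in the leading terms
   of that error.  When v solves the equation, [kg_op] vanishes. *)
Definition consistent_order_2_2 (beta gamma m : R) : Prop :=
  forall (U : R -> R -> Prop) (v : R -> R -> R),
  (forall r t, U r t -> locally_2d U r t) ->
  (forall r t, U r t -> ex_diff_n v 5 r t) ->
  forall a b c d : R,
  (forall r t, a <= r <= b -> c <= t <= d -> U r t) ->
  exists C : R, forall (dt dr : R) (j n : Z),
    0 < dt -> 0 < dr ->
    a <= IZR (j - 1) * dr -> IZR (j + 1) * dr <= b ->
    c <= IZR (n - 1) * dt -> IZR (n + 1) * dt <= d ->
    Rabs (scheme beta gamma m dt dr (sample dt dr v) j n
          - kg_op beta gamma m v (IZR j * dr) (IZR n * dt))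
    <= C * (dt ^ 2 + dr ^ 2).

Definition khat (beta gamma m dt dr xi : R) : R :=
  1 + gamma * (dt / 2) + 2 * (beta * dt / dr ^ 2) * sin (xi / 2) ^ 2
  + m ^ 2 * (dt ^ 2 / 2).

Definition hhat (beta gamma m dt dr xi : R) : R :=
  1 - gamma * (dt / 2) - 2 * (beta * dt / dr ^ 2) * sin (xi / 2) ^ 2
  + m ^ 2 * (dt ^ 2 / 2).

Definition mat2 (a b c d : R) : @matrix R 2 2 :=
  mk_matrix 2 2 (fun i j => match i, j with
                            | O, O => a
                            | O, S _ => b
                            | S _, O => c
                            | S _, S _ => d
                            end).

Definition amplification (beta gamma m dt dr xi : R) : @matrix R 2 2 :=
  mat2 (2 / khat beta gamma m dt dr xi
          * (1 - 2 * (dt / dr) ^ 2 * sin (xi / 2) ^ 2))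
       (- (hhat beta gamma m dt dr xi / khat beta gamma m dt dr xi))
       1 0.

Definition vnorm (x : @matrix R 2 1) : R :=
  sqrt (coeff_mat 0 x 0 0 ^ 2 + coeff_mat 0 x 1 0 ^ 2).

(* The operator norm induced by the Euclidean norm of R^2. *)
Definition opnorm (A : @matrix R 2 2) : Rbar :=
  Lub_Rbar (fun s => exists x : @matrix R 2 1,
                       vnorm x = 1 /\ s = vnorm (@Mmult R_Ring 2 2 1 A x)).

(* Division is total, so this is meaningful only when khat never vanishes, which
   is automatic for beta, gamma >= 0.

   Stability of order n implies the strict inequality 1 - 2 R^2 > - khat(PI)
   except when hhat(PI) = khat(PI), i.e. gamma + 4 beta / dr^2 = 0 (for
   nonnegative coefficients: no damping at all).  There equality can occur: for
   beta = gamma = m = 0 and R = 1 the matrix at xi = PI is ((-2, -1), (1, 0)),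
   a Jordan block for -1, and the entries of the n-th power at xi are Chebyshev
   values U_k (cos xi), k <= n, bounded by n + 1. *)
Definition stable_of_order_n (beta gamma m dt dr : R) : Prop :=
  exists K1 K2 : R, forall (n : nat) (xi : R),
    Rbar_le
      (opnorm (@pow_n (@matrix_Ring R_Ring 2)
                      (amplification beta gamma m dt dr xi) n))
      (Finite (K1 + INR n * K2)).

(* On a Fourier mode of frequency xi with amplitudes c_n, the scheme reads
   khat c_{n+1} - 2 (1 - 2 R^2 sin^2 (xi/2)) c_n + hhat c_{n-1} = 0; this is the
   recurrence of which [amplification] is the companion matrix. *)
Lemma scheme_fourier_mode (beta gamma m dt dr xi theta : R) (c : Z -> R)
    (j n : Z) :
  0 < dt -> 0 < dr ->
  scheme beta gamma m dt dr
    (fun i k => c k * cos (IZR i * xi + theta)) j n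
  = (khat beta gamma m dt dr xi * c (n + 1)%Z
     - 2 * (1 - 2 * (dt / dr) ^ 2 * sin (xi / 2) ^ 2) * c n
     + hhat beta gamma m dt dr xi * c (n - 1)%Z)
    * cos (IZR j * xi + theta) / dt ^ 2.
Proof.
intros Ht Hr.
assert (E : cos (IZR (j + 1) * xi + theta) + cos (IZR (j - 1) * xi + theta)
            = (2 - 4 * sin (xi / 2) ^ 2) * cos (IZR j * xi + theta)).
{ rewrite plus_IZR, minus_IZR.
  replace ((IZR j + 1) * xi + theta) with (IZR j * xi + theta + xi) by ring.
  replace ((IZR j - 1) * xi + theta) with (IZR j * xi + theta - xi) by ring.
  rewrite cos_plus, cos_minus.
  replace (cos xi) with (1 - 2 * sin (xi / 2) * sin (xi / 2)).
  - ring.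
  - rewrite <- cos_2a_sin. f_equal. field. }
assert (D : forall k, delta02 (fun i k => c k * cos (IZR i * xi + theta)) j k
            = - 4 * sin (xi / 2) ^ 2 * c k * cos (IZR j * xi + theta)).
{ intro k. unfold delta02.
  replace (cos (IZR (j + 1) * xi + theta)) with
    ((2 - 4 * sin (xi / 2) ^ 2) * cos (IZR j * xi + theta)
     - cos (IZR (j - 1) * xi + theta)) by (rewrite <- E; ring).
  ring. }
unfold scheme. rewrite !D. unfold khat, hhat. field. lra.
Qed.

(* Main.v *)
(** Consistency: by the mean value theorem, a central difference of first or
    second order differs from the derivative by the square of the step times a
    bound for the derivative two orders higher, and continuous derivatives are
    bounded on a compact rectangle.  The mixed term is the [r]-difference of
    [x |-> v x (t + dt) - v x (t - dt)], whose derivatives in [x] are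
    themselves first differences in [t].

    Stability: only [xi = PI] matters.  At most linear growth of the powers
    forces [Rabs (hhat / khat) <= 1] (the determinant) and every real eigenvalue
    into [[-1, 1]].  As [khat + hhat = 2 + m^2 dt^2 > 0], the determinant bound
    gives [khat > 0] and [hhat <= khat], that is [gamma + 4 beta / dr^2 >= 0];
    the characteristic polynomial being nonnegative at [-1] gives
    [R^2 <= 1 + m^2 dt^2 / 4].  Together these imply the claim. *)

Require Import Defs.
From Stdlib Require Import Reals ZArith Lra Lia.
From Coquelicot Require Import Coquelicot.
Open Scope R_scope.

(** * Central difference estimates in one variable *)

(** Mean value theorem on [[0, h]]. Below, [f] is a difference or its error as a function of the
    step, so it vanishes at step 0. Its derivative in the step is a difference or error of [f1]
    instead, already bounded by the preceding estimate. *)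
Lemma increment_le (f g : R -> R) (h D : R) :
  0 <= h -> f 0 = 0 ->
  (forall s, 0 <= s <= h -> is_derive f s (g s) /\ Rabs (g s) <= D) ->
  Rabs (f h) <= D * h.
Proof.
intros Hh H0 H.
destruct (MVT_gen f 0 h g) as [c [Hc E]].
- intros s. rewrite Rmin_left, Rmax_right by lra. intro Hs. apply H. lra.
- intros s. rewrite Rmin_left, Rmax_right by lra. intro Hs.
  apply derivable_continuous_pt. exists (g s).
  apply is_derive_Reals, H. lra.
- rewrite Rmin_left, Rmax_right in Hc by lra.
  replace (f h) with (g c * h) by lra.
  rewrite Rabs_mult, (Rabs_pos_eq h) by lra.
  apply Rmult_le_compat_r; [lra | apply H; lra].
Qed.

Lemma is_derive_shift_plus (f : R -> R) (x s l : R) :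
  is_derive f (x + s) l -> is_derive (fun u => f (x + u)) s l.
Proof.
intro H. auto_derive.
- exists l. exact H.
- rewrite Rmult_1_l. now apply is_derive_unique.
Qed.

Lemma is_derive_shift_minus (f : R -> R) (x s l : R) :
  is_derive f (x - s) l -> is_derive (fun u => f (x - u)) s (- l).
Proof.
intro H. auto_derive.
- exists l. exact H.
- replace (x + - s) with (x - s) by ring.
  replace (Derive _ (x - s)) with l by (symmetry; now apply is_derive_unique).
  ring.
Qed.

Lemma first_difference_le (f f1 : R -> R) (x h M : R) :
  0 <= h ->
  (forall y, x - h <= y <= x + h -> is_derive f y (f1 y) /\ Rabs (f1 y) <= M) ->
  Rabs (f (x + h) - f (x - h)) <= 2 * M * h.
Proof.
intros Hh H.
apply (increment_le (fun s => f (x + s) - f (x - s))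
         (fun s => f1 (x + s) - - f1 (x - s)) h (2 * M)); auto.
- rewrite Rplus_0_r, Rminus_0_r. ring.
- intros s Hs.
  destruct (H (x + s)) as [Dp Bp]; [lra |].
  destruct (H (x - s)) as [Dm Bm]; [lra |].
  split.
  + apply (is_derive_minus (fun u => f (x + u)) (fun u => f (x - u))).
    * now apply is_derive_shift_plus.
    * now apply is_derive_shift_minus.
  + apply Rabs_le_between in Bp, Bm. apply Rabs_le. lra.
Qed.

Lemma second_difference_le (f f1 f2 : R -> R) (x h M : R) :
  0 <= h ->
  (forall y, x - h <= y <= x + h -> is_derive f y (f1 y)) ->
  (forall y, x - h <= y <= x + h -> is_derive f1 y (f2 y) /\ Rabs (f2 y) <= M) ->
  Rabs (f (x + h) - 2 * f x + f (x - h)) <= 2 * M * h ^ 2.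
Proof.
intros Hh H1 H2.
replace (2 * M * h ^ 2) with (2 * M * h * h) by ring.
assert (HM : 0 <= M).
{ apply Rle_trans with (Rabs (f2 x)); [apply Rabs_pos | apply H2; lra]. }
apply (increment_le (fun s => f (x + s) - 2 * f x + f (x - s))
         (* The derivative is written as the sum and difference rules produce it; [0] comes from the
            constant [2 * f x]. *)
         (fun s => f1 (x + s) - 0 + - f1 (x - s)) h); auto.
- rewrite Rplus_0_r, Rminus_0_r. ring.
- intros s Hs. split.
  + apply (is_derive_plus (fun u => f (x + u) - 2 * f x) (fun u => f (x - u))).
    * apply (is_derive_minus (fun u => f (x + u)) (fun _ => 2 * f x)).
      -- apply is_derive_shift_plus, H1. lra.
      -- apply (is_derive_const (2 * f x)).
    * apply is_derive_shift_minus, H1. lra.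
  + rewrite Rminus_0_r. fold (f1 (x + s) - f1 (x - s)).
    apply Rle_trans with (2 * M * s); [| nra].
    apply first_difference_le with f2; [lra |].
    intros y Hy. apply H2. lra.
Qed.

(** The derivative of the error in the step is the second difference of [f1]. Bounding [s] by [h]
    rather than integrating costs only a constant factor. *)
Lemma first_difference_error (f f1 f2 f3 : R -> R) (x h M : R) :
  0 <= h ->
  (forall y, x - h <= y <= x + h -> is_derive f y (f1 y)) ->
  (forall y, x - h <= y <= x + h -> is_derive f1 y (f2 y)) ->
  (forall y, x - h <= y <= x + h -> is_derive f2 y (f3 y) /\ Rabs (f3 y) <= M) ->
  Rabs (f (x + h) - f (x - h) - h * (2 * f1 x)) <= 2 * M * h ^ 3.
Proof.
intros Hh H1 H2 H3.
replace (2 * M * h ^ 3) with (2 * M * h ^ 2 * h) by ring.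
assert (HM : 0 <= M).
{ apply Rle_trans with (Rabs (f3 x)); [apply Rabs_pos | apply H3; lra]. }
apply (increment_le (fun s => f (x + s) - f (x - s) - s * (2 * f1 x))
         (fun s => f1 (x + s) - - f1 (x - s) - 2 * f1 x) h); auto.
- rewrite Rplus_0_r, Rminus_0_r. ring.
- intros s Hs. split.
  + apply (is_derive_minus (fun u => f (x + u) - f (x - u))
                           (fun u => u * (2 * f1 x))).
    * apply (is_derive_minus (fun u => f (x + u)) (fun u => f (x - u))).
      -- apply is_derive_shift_plus, H1. lra.
      -- apply is_derive_shift_minus, H1. lra.
    * auto_derive; [exact I | ring].
  + replace (f1 (x + s) - - f1 (x - s) - 2 * f1 x)
      with (f1 (x + s) - 2 * f1 x + f1 (x - s)) by ring.
    apply Rle_trans with (2 * M * s ^ 2).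
    * apply second_difference_le with f2 f3; [lra | |];
        intros y Hy; [apply H2 | apply H3]; lra.
    * apply Rmult_le_compat_l; [lra |]. apply pow_incr. lra.
Qed.

(** The derivative of the error in the step is the first-difference error of [f1]. *)
Lemma second_difference_error (f f1 f2 f3 f4 : R -> R) (x h M : R) :
  0 <= h ->
  (forall y, x - h <= y <= x + h -> is_derive f y (f1 y)) ->
  (forall y, x - h <= y <= x + h -> is_derive f1 y (f2 y)) ->
  (forall y, x - h <= y <= x + h -> is_derive f2 y (f3 y)) ->
  (forall y, x - h <= y <= x + h -> is_derive f3 y (f4 y) /\ Rabs (f4 y) <= M) ->
  Rabs (f (x + h) - 2 * f x + f (x - h) - h ^ 2 * f2 x) <= 2 * M * h ^ 4.
Proof.
intros Hh H1 H2 H3 H4.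
replace (2 * M * h ^ 4) with (2 * M * h ^ 3 * h) by ring.
assert (HM : 0 <= M).
{ apply Rle_trans with (Rabs (f4 x)); [apply Rabs_pos | apply H4; lra]. }
apply (increment_le (fun s => f (x + s) - 2 * f x + f (x - s) - s ^ 2 * f2 x)
         (fun s => f1 (x + s) - 0 + - f1 (x - s) - s * (2 * f2 x)) h); auto.
- rewrite Rplus_0_r, Rminus_0_r. ring.
- intros s Hs. split.
  + apply (is_derive_minus (fun u => f (x + u) - 2 * f x + f (x - u))
                           (fun u => u ^ 2 * f2 x)).
    * apply (is_derive_plus (fun u => f (x + u) - 2 * f x) (fun u => f (x - u))).
      -- apply (is_derive_minus (fun u => f (x + u)) (fun _ => 2 * f x)).
         ++ apply is_derive_shift_plus, H1. lra.
         ++ apply (is_derive_const (2 * f x)).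
      -- apply is_derive_shift_minus, H1. lra.
    * auto_derive; [exact I | ring].
  + replace (f1 (x + s) - 0 + - f1 (x - s) - s * (2 * f2 x))
      with (f1 (x + s) - f1 (x - s) - s * (2 * f2 x)) by ring.
    apply Rle_trans with (2 * M * s ^ 3).
    * apply first_difference_error with f3 f4; [lra | | |];
        intros y Hy; [apply H2 | apply H3 | apply H4]; lra.
    * apply Rmult_le_compat_l; [lra |]. apply pow_incr. lra.
Qed.

(** * Bounds on a compact rectangle and iterated partial derivatives *)

(** By uniform continuity, a move of at most [e / 2] in each coordinate changes [f] by less than 1,
    and a fixed number of such moves leads from any point to the corner [(a, c)]. *)
Lemma continuity_2d_bounded (f : R -> R -> R) (a b c d : R) :
  (forall x y, a <= x <= b -> c <= y <= d -> continuity_2d_pt f x y) ->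
  exists M, 0 <= M /\
    forall x y, a <= x <= b -> c <= y <= d -> Rabs (f x y) <= M.
Proof.
intro Hf.
destruct (uniform_continuity_2d f a b c d Hf (mkposreal 1 Rlt_0_1)) as [e He].
simpl in He. pose proof (cond_pos e) as Hpos.
assert (chain : forall n x y, a <= x <= b -> c <= y <= d ->
  x - a <= INR n * (e / 2) -> y - c <= INR n * (e / 2) ->
  Rabs (f x y) <= Rabs (f a c) + INR n).
{ induction n as [| n IH]; intros x y Hx Hy Ha Hc.
  - simpl in Ha, Hc. replace x with a by lra. replace y with c by lra.
    simpl. lra.
  - rewrite S_INR in *.
    pose proof (pos_INR n).
    (* One move towards the corner, stopped at the sides [a] and [c] so as to stay in the
       rectangle. *)
    set (x' := Rmax a (x - e / 2)). set (y' := Rmax c (y - e / 2)).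
    assert (X : a <= x' <= x /\ x - x' <= e / 2 /\ x' - a <= INR n * (e / 2)).
    { unfold x', Rmax. destruct Rle_dec; split; try split; nra. }
    assert (Y : c <= y' <= y /\ y - y' <= e / 2 /\ y' - c <= INR n * (e / 2)).
    { unfold y', Rmax. destruct Rle_dec; split; try split; nra. }
    assert (B : Rabs (f x y - f x' y') < 1).
    { apply He; try lra; apply Rabs_lt_between; lra. }
    assert (B' := IH x' y' ltac:(lra) ltac:(lra) ltac:(lra) ltac:(lra)).
    pose proof (Rabs_triang (f x' y') (f x y - f x' y')) as T.
    replace (f x' y' + (f x y - f x' y')) with (f x y) in T by ring. lra. }
destruct (INR_unbounded ((Rabs (b - a) + Rabs (d - c)) / (e / 2))) as [n Hn].
assert (Hn' : Rabs (b - a) + Rabs (d - c) <= INR n * (e / 2)).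
{ apply Rlt_div_l in Hn; lra. }
exists (Rabs (f a c) + INR n). split.
- pose proof (Rabs_pos (f a c)). pose proof (pos_INR n). lra.
- intros x y Hx Hy.
  pose proof (Rle_abs (b - a)). pose proof (Rle_abs (d - c)).
  pose proof (Rabs_pos (b - a)). pose proof (Rabs_pos (d - c)).
  apply chain; lra.
Qed.

(** Named so that [peel_partials] can recognise iterated partial derivatives; convertible to the
    functions on which [ex_diff_n] recurses. *)
Definition partial_r (f : R -> R -> R) (r t : R) : R := Derive (fun x => f x t) r.
Definition partial_t (f : R -> R -> R) (r t : R) : R := Derive (fun s => f r s) t.

Section Smooth.

Variables (f : R -> R -> R) (n : nat) (r t : R).
Hypothesis Hf : ex_diff_n f (S n) r t.

Lemma ex_diff_n_partial_r : ex_diff_n (partial_r f) n r t.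
Proof. apply Hf. Qed.

Lemma ex_diff_n_partial_t : ex_diff_n (partial_t f) n r t.
Proof. apply Hf. Qed.

Lemma is_derive_partial_r : is_derive (fun x => f x t) r (partial_r f r t).
Proof. apply Derive_correct, Hf. Qed.

Lemma is_derive_partial_t : is_derive (fun s => f r s) t (partial_t f r t).
Proof. apply Derive_correct, Hf. Qed.

End Smooth.

Ltac peel_partials :=
  repeat match goal with
  | |- ex_diff_n (partial_r _) _ _ _ => apply ex_diff_n_partial_r
  | |- ex_diff_n (partial_t _) _ _ _ => apply ex_diff_n_partial_t
  end.

Lemma ex_diff_n_continuity (f : R -> R -> R) (n : nat) (r t : R) :
  ex_diff_n f n r t -> continuity_2d_pt f r t.
Proof. destruct n; intro H; apply H. Qed.

Lemma ex_diff_n_bounded (f : R -> R -> R) (n : nat) (a b c d : R) :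
  (forall r t, a <= r <= b -> c <= t <= d -> ex_diff_n f n r t) ->
  exists M, 0 <= M /\
    forall r t, a <= r <= b -> c <= t <= d -> Rabs (f r t) <= M.
Proof.
intro H. apply continuity_2d_bounded. intros r t Hr Ht.
now apply ex_diff_n_continuity with n, H.
Qed.

(** * Truncation error of the scheme, term by term *)

Lemma Rabs_div_le (x c B : R) : 0 < c -> Rabs x <= B * c -> Rabs (x / c) <= B.
Proof.
intros Hc H. rewrite Rabs_div, (Rabs_pos_eq c) by lra.
apply Rle_div_l; lra.
Qed.

Section TruncationError.

Variables (beta gamma m : R) (v : R -> R -> R) (r t h k M : R).
Hypothesis h_pos : 0 < h.
Hypothesis k_pos : 0 < k.

(** The rectangle spanned by the nine stencil points, with [h] the step in space and [k] the step in
    time. *)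
Let inside (x s : R) : Prop := r - h <= x <= r + h /\ t - k <= s <= t + k.

Hypothesis Hv : forall x s, inside x s -> ex_diff_n v 5 x s.

Notation vr := (partial_r v).
Notation vrr := (partial_r vr).
Notation vrrr := (partial_r vrr).
Notation vrrrr := (partial_r vrrr).
Notation vt := (partial_t v).
Notation vtt := (partial_t vt).
Notation vttt := (partial_t vtt).
Notation vtttt := (partial_t vttt).

Hypothesis bound_tt : forall x s, inside x s -> Rabs (vtt x s) <= M.
Hypothesis bound_ttt : forall x s, inside x s -> Rabs (vttt x s) <= M.
Hypothesis bound_tttt : forall x s, inside x s -> Rabs (vtttt x s) <= M.
Hypothesis bound_rrrr : forall x s, inside x s -> Rabs (vrrrr x s) <= M.
Hypothesis bound_rrrrt :
  forall x s, inside x s -> Rabs (partial_t vrrrr x s) <= M.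
Hypothesis bound_rrttt :
  forall x s, inside x s -> Rabs (partial_t (partial_t (partial_t vrr)) x s) <= M.

Ltac smooth :=
  peel_partials;
  match goal with |- ex_diff_n v ?n _ _ =>
    apply (ex_diff_n_m 5 n); [lia | apply Hv; unfold inside; lra] end.
Ltac derive_t := apply is_derive_partial_t with O; smooth.
Ltac derive_r := apply is_derive_partial_r with O; smooth.

Lemma second_t_difference_error :
  Rabs ((v r (t + k) - 2 * v r t + v r (t - k)) / k ^ 2 - vtt r t)
  <= 2 * M * k ^ 2.
Proof.
replace (_ / k ^ 2 - _) with
  ((v r (t + k) - 2 * v r t + v r (t - k) - k ^ 2 * vtt r t) / k ^ 2)
  by (field; lra).
apply Rabs_div_le; [now apply pow_lt |].
replace (2 * M * k ^ 2 * k ^ 2) with (2 * M * k ^ 4) by ring.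
apply (second_difference_error (fun s => v r s) (vt r) (vtt r) (vttt r)
         (vtttt r)); [lra | | | |]; intros s Hs; [derive_t .. | split].
- derive_t.
- apply bound_tttt. unfold inside. lra.
Qed.

Lemma second_r_difference_error :
  Rabs ((v (r + h) t - 2 * v r t + v (r - h) t) / h ^ 2 - vrr r t)
  <= 2 * M * h ^ 2.
Proof.
replace (_ / h ^ 2 - _) with
  ((v (r + h) t - 2 * v r t + v (r - h) t - h ^ 2 * vrr r t) / h ^ 2)
  by (field; lra).
apply Rabs_div_le; [now apply pow_lt |].
replace (2 * M * h ^ 2 * h ^ 2) with (2 * M * h ^ 4) by ring.
apply (second_difference_error (fun x => v x t) (fun x => vr x t)
         (fun x => vrr x t) (fun x => vrrr x t) (fun x => vrrrr x t));
  [lra | | | |]; intros x Hx; [derive_r .. | split].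
- derive_r.
- apply bound_rrrr. unfold inside. lra.
Qed.

Lemma first_t_difference_error :
  Rabs ((v r (t + k) - v r (t - k)) / (2 * k) - vt r t) <= M * k ^ 2.
Proof.
replace (_ / (2 * k) - _) with
  ((v r (t + k) - v r (t - k) - k * (2 * vt r t)) / (2 * k)) by (field; lra).
apply Rabs_div_le; [lra |].
replace (M * k ^ 2 * (2 * k)) with (2 * M * k ^ 3) by ring.
apply (first_difference_error (fun s => v r s) (vt r) (vtt r) (vttt r));
  [lra | | |]; intros s Hs; [derive_t .. | split].
- derive_t.
- apply bound_ttt. unfold inside. lra.
Qed.

(** The scheme replaces [m ^ 2 * v] by an average over two time levels; the discrepancy is
    [m ^ 2 / 2] times this second difference. *)
Lemma time_average_error :
  Rabs (v r (t + k) - 2 * v r t + v r (t - k)) <= 2 * M * k ^ 2.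
Proof.
apply (second_difference_le (fun s => v r s) (vt r) (vtt r));
  [lra | |]; intros s Hs; [derive_t .. | split].
- derive_t.
- apply bound_tt. unfold inside. lra.
Qed.

(* Differencing in [r] first produces the derivatives in the order
   [d/dt d^2/dr^2] of [kg_op], so that no exchange of partial derivatives is
   needed. *)
Lemma mixed_difference_error :
  Rabs (((v (r + h) (t + k) - 2 * v r (t + k) + v (r - h) (t + k))
         - (v (r + h) (t - k) - 2 * v r (t - k) + v (r - h) (t - k)))
        / (2 * k * h ^ 2) - partial_t vrr r t)
  <= 2 * M * h ^ 2 + M * k ^ 2.
Proof.
set (P := fun (w : R -> R -> R) x => w x (t + k) - w x (t - k)).
assert (DP : forall (w : R -> R -> R) x,
  ex_diff_n w 1 x (t + k) -> ex_diff_n w 1 x (t - k) ->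
  is_derive (P w) x (P (partial_r w) x)).
{ intros w x Hp Hm.
  apply (is_derive_minus (fun x => w x (t + k)) (fun x => w x (t - k)));
    now apply is_derive_partial_r with O. }
(* The error splits in two: [E1] replaces the [r]-difference of [P v] by [P vrr], and [E2] then
   replaces the time difference of [vrr] by its derivative. *)
assert (E1 : Rabs ((P v (r + h) - 2 * P v r + P v (r - h) - h ^ 2 * P vrr r)
                   / (2 * k * h ^ 2)) <= 2 * M * h ^ 2).
{ apply Rabs_div_le.
  { apply Rmult_lt_0_compat; [lra | now apply pow_lt]. }
  (* The fourth derivative of [P v] is a time difference of [vrrrr], hence at most [2 * M * k]; this
     factor [k] cancels the one in the denominator. *)
  replace (2 * M * h ^ 2 * (2 * k * h ^ 2)) with (2 * (2 * M * k) * h ^ 4) by ring.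
  apply (second_difference_error (P v) (P vr) (P vrr) (P vrrr) (P vrrrr));
    [lra | | | |]; intros x Hx; [apply DP; smooth .. | split].
  - apply DP; smooth.
  - apply (first_difference_le (vrrrr x) (partial_t vrrrr x)); [lra |].
    intros s Hs. split.
    + derive_t.
    + apply bound_rrrrt. unfold inside. lra. }
assert (E2 : Rabs ((P vrr r - k * (2 * partial_t vrr r t)) / (2 * k)) <= M * k ^ 2).
{ apply Rabs_div_le; [lra |].
  replace (M * k ^ 2 * (2 * k)) with (2 * M * k ^ 3) by ring.
  apply (first_difference_error (vrr r) (partial_t vrr r)
           (partial_t (partial_t vrr) r)
           (partial_t (partial_t (partial_t vrr)) r));
    [lra | | |]; intros s Hs; [derive_t .. | split].
  - derive_t.
  - apply bound_rrttt. unfold inside. lra. }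
match type of E1 with Rabs ?x <= _ => match type of E2 with Rabs ?y <= _ =>
  pose proof (Rabs_triang x y) as T;
  replace (_ / (2 * k * h ^ 2) - partial_t vrr r t) with (x + y)
    by (unfold P; field; lra) end end.
lra.
Qed.

Lemma truncation_error_le :
  Rabs ((v r (t + k) - 2 * v r t + v r (t - k)) / k ^ 2
        - (v (r + h) t - 2 * v r t + v (r - h) t) / h ^ 2
        + gamma * ((v r (t + k) - v r (t - k)) / (2 * k))
        - beta * (((v (r + h) (t + k) - 2 * v r (t + k) + v (r - h) (t + k))
                   - (v (r + h) (t - k) - 2 * v r (t - k) + v (r - h) (t - k)))
                  / (2 * k * h ^ 2))
        + m ^ 2 / 2 * (v r (t + k) + v r (t - k))
        - kg_op beta gamma m v r t)
  <= (2 + Rabs gamma + 2 * Rabs beta + m ^ 2) * M * (k ^ 2 + h ^ 2).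
Proof.
(* [Derive_n _ 2] unfolds to two nested [Derive], so the iterated partials agree by conversion. *)
change (kg_op beta gamma m v r t) with
  (vtt r t - vrr r t + gamma * vt r t - beta * partial_t vrr r t
   + m ^ 2 * v r t).
pose proof second_t_difference_error as E1.
pose proof second_r_difference_error as E2.
pose proof first_t_difference_error as E3.
pose proof mixed_difference_error as E4.
pose proof time_average_error as E5.
match type of E1 with Rabs ?x <= _ => set (e1 := x) in * end.
match type of E2 with Rabs ?x <= _ => set (e2 := x) in * end.
match type of E3 with Rabs ?x <= _ => set (e3 := x) in * end.
match type of E4 with Rabs ?x <= _ => set (e4 := x) in * end.
match type of E5 with Rabs ?x <= _ => set (e5 := x) in * end.
match goal with |- Rabs ?x <= _ =>
  replace x with (e1 - e2 + gamma * e3 - beta * e4 + m ^ 2 / 2 * e5)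
    by (unfold e1, e2, e3, e4, e5; field; lra) end.
assert (B3 : Rabs (gamma * e3) <= Rabs gamma * (M * k ^ 2)).
{ rewrite Rabs_mult. apply Rmult_le_compat_l; auto. apply Rabs_pos. }
assert (B4 : Rabs (beta * e4) <= Rabs beta * (2 * M * h ^ 2 + M * k ^ 2)).
{ rewrite Rabs_mult. apply Rmult_le_compat_l; auto. apply Rabs_pos. }
assert (B5 : Rabs (m ^ 2 / 2 * e5) <= m ^ 2 / 2 * (2 * M * k ^ 2)).
{ pose proof (pow2_ge_0 m).
  rewrite Rabs_mult, (Rabs_pos_eq (m ^ 2 / 2)) by lra.
  apply Rmult_le_compat_l; auto. lra. }
assert (HM : 0 <= M).
{ apply Rle_trans with (Rabs (vtt r t)); [apply Rabs_pos |].
  apply bound_tt. unfold inside. lra. }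
(* These nonnegative products are what the separate bounds lack to reach the common factor
   [k ^ 2 + h ^ 2]. *)
assert (0 <= Rabs gamma * (M * h ^ 2)).
{ repeat apply Rmult_le_pos; auto using Rabs_pos; lra. }
assert (0 <= Rabs beta * (M * k ^ 2)).
{ repeat apply Rmult_le_pos; auto using Rabs_pos; lra. }
assert (0 <= m ^ 2 * (M * h ^ 2)).
{ apply Rmult_le_pos; [apply pow2_ge_0 |].
  repeat apply Rmult_le_pos; lra. }
apply Rabs_le_between in E1, E2, B3, B4, B5.
apply Rabs_le. lra.
Qed.

End TruncationError.

Lemma scheme_consistent (beta gamma m : R) : consistent_order_2_2 beta gamma m.
Proof.
intros U v _ HU a b c d Hrect.
assert (Hv : forall r t, a <= r <= b -> c <= t <= d -> ex_diff_n v 5 r t) by auto.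
assert (bounded : forall (w : R -> R -> R) (n : nat),
  (forall r t, ex_diff_n v 5 r t -> ex_diff_n w n r t) ->
  exists M, 0 <= M /\
    forall r t, a <= r <= b -> c <= t <= d -> Rabs (w r t) <= M).
{ intros w n Hw. apply ex_diff_n_bounded with n. auto. }
(* The six derivatives in the error bounds; the numeral in each is the order of differentiability
   left out of five. *)
destruct (bounded (partial_t (partial_t v)) 3%nat) as [M1 [P1 B1]].
{ intros r t H. peel_partials. exact H. }
destruct (bounded (partial_t (partial_t (partial_t v))) 2%nat) as [M2 [P2 B2]].
{ intros r t H. peel_partials. exact H. }
destruct (bounded (partial_t (partial_t (partial_t (partial_t v)))) 1%nat)
  as [M3 [P3 B3]].
{ intros r t H. peel_partials. exact H. }
destruct (bounded (partial_r (partial_r (partial_r (partial_r v)))) 1%nat)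
  as [M4 [P4 B4]].
{ intros r t H. peel_partials. exact H. }
destruct (bounded (partial_t (partial_r (partial_r (partial_r (partial_r v)))))
            0%nat) as [M5 [P5 B5]].
{ intros r t H. peel_partials. exact H. }
destruct (bounded (partial_t (partial_t (partial_t (partial_r (partial_r v)))))
            0%nat) as [M6 [P6 B6]].
{ intros r t H. peel_partials. exact H. }
(* A sum of nonnegative bounds dominates each of them, and it does not depend on the steps. *)
set (M := M1 + M2 + M3 + M4 + M5 + M6).
set (C := (2 + Rabs gamma + 2 * Rabs beta + m ^ 2) * M).
exists C.
intros dt dr j n Ht Hr Ha Hb Hc Hd.
rewrite minus_IZR, Rmult_minus_distr_r, Rmult_1_l in Ha, Hc.
rewrite plus_IZR, Rmult_plus_distr_r, Rmult_1_l in Hb, Hd.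
unfold scheme, delta02, sample.
rewrite !plus_IZR, !minus_IZR, !Rmult_plus_distr_r, !Rmult_minus_distr_r,
  !Rmult_1_l.
set (r := IZR j * dr) in *. set (t := IZR n * dt) in *.
apply (truncation_error_le beta gamma m v r t dr dt M); auto; intros x s [Hx Hs].
- apply Hv; lra.
- apply Rle_trans with M1; [apply B1; lra | unfold M; lra].
- apply Rle_trans with M2; [apply B2; lra | unfold M; lra].
- apply Rle_trans with M3; [apply B3; lra | unfold M; lra].
- apply Rle_trans with M4; [apply B4; lra | unfold M; lra].
- apply Rle_trans with M5; [apply B5; lra | unfold M; lra].
- apply Rle_trans with M6; [apply B6; lra | unfold M; lra].
Qed.

(** * Determinant, eigenvectors and operator norm of matrices of order two *)

Local Notation entry M i j := (coeff_mat (0 : R) (M : @matrix R 2 2) i j).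

Definition col2 (x y : R) : @matrix R 2 1 :=
  mk_matrix 2 1 (fun i _ => match i with O => x | S _ => y end).

Definition det2 (M : @matrix R 2 2) : R :=
  entry M 0 0 * entry M 1 1 - entry M 0 1 * entry M 1 0.

Lemma coeff_mult2 (k : nat) (M : @matrix R 2 2) (N : @matrix R 2 k) (i j : nat) :
  (i < 2)%nat -> (j < k)%nat ->
  coeff_mat (0 : R) (@Mmult R_Ring 2 2 k M N) i j
  = entry M i 0 * coeff_mat (0 : R) N 0 j + entry M i 1 * coeff_mat (0 : R) N 1 j.
Proof.
intros Hi Hj. unfold Mmult. rewrite coeff_mat_bij; auto.
simpl pred. rewrite sum_Sn, sum_O. reflexivity.
Qed.

Lemma det2_mult (M N : @matrix R 2 2) :
  det2 (@Mmult R_Ring 2 2 2 M N) = det2 M * det2 N.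
Proof. unfold det2. rewrite !coeff_mult2 by lia. ring. Qed.

Lemma det2_pow (M : @matrix R 2 2) (n : nat) :
  det2 (@pow_n (@matrix_Ring R_Ring 2) M n) = det2 M ^ n.
Proof.
induction n as [| n IH].
- unfold det2. simpl. unfold coeff_mat. simpl. unfold one, zero. simpl. ring.
- simpl. rewrite <- IH. apply det2_mult.
Qed.

(** The least upper bound dominates the value at the unit vector [(x, y)]; squaring removes the
    roots and leaves polynomial inequalities. *)
Lemma opnorm_le_vector (M : @matrix R 2 2) (B x y : R) :
  Rbar_le (opnorm M) (Finite B) -> x ^ 2 + y ^ 2 = 1 ->
  (entry M 0 0 * x + entry M 0 1 * y) ^ 2
  + (entry M 1 0 * x + entry M 1 1 * y) ^ 2 <= B ^ 2.
Proof.
intros HB Hxy.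
assert (H : vnorm (@Mmult R_Ring 2 2 1 M (col2 x y)) <= B).
{ apply (Rbar_le_trans (Finite _) (opnorm M) (Finite B)); auto.
  destruct (Lub_Rbar_correct (fun s => exists x : @matrix R 2 1,
     vnorm x = 1 /\ s = vnorm (@Mmult R_Ring 2 2 1 M x))) as [ub _].
  apply ub. exists (col2 x y). split; auto.
  unfold vnorm. change (sqrt (x ^ 2 + y ^ 2) = 1). rewrite Hxy. apply sqrt_1. }
unfold vnorm in H. rewrite !coeff_mult2 in H by lia.
change (coeff_mat 0 (col2 x y) 0 0) with x in H.
change (coeff_mat 0 (col2 x y) 1 0) with y in H.
set (p := entry M 0 0 * x + entry M 0 1 * y) in *.
set (q := entry M 1 0 * x + entry M 1 1 * y) in *.
rewrite <- (pow2_sqrt (p ^ 2 + q ^ 2)) by nra.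
apply pow_incr. split; auto. apply sqrt_pos.
Qed.

(** The two basis vectors show that each column has squared length at most [B ^ 2], and the
    determinant is at most half the sum of the squared entries in absolute value. *)
Lemma det2_le_opnorm (M : @matrix R 2 2) (B : R) :
  Rbar_le (opnorm M) (Finite B) -> Rabs (det2 M) <= B ^ 2.
Proof.
intro HB.
pose proof (opnorm_le_vector M B 1 0 HB ltac:(lra)) as H1.
pose proof (opnorm_le_vector M B 0 1 HB ltac:(lra)) as H2.
rewrite !Rmult_1_r, !Rmult_0_r, ?Rplus_0_r, ?Rplus_0_l in H1, H2.
unfold det2. apply Rabs_le.
pose proof (pow2_ge_0 (entry M 0 0 - entry M 1 1)).
pose proof (pow2_ge_0 (entry M 0 0 + entry M 1 1)).
pose proof (pow2_ge_0 (entry M 0 1 - entry M 1 0)).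
pose proof (pow2_ge_0 (entry M 0 1 + entry M 1 0)).
split; lra.
Qed.

Lemma pow_n_eigenvector (M : @matrix R 2 2) (l x y : R) (n : nat) :
  entry M 0 0 * x + entry M 0 1 * y = l * x ->
  entry M 1 0 * x + entry M 1 1 * y = l * y ->
  let P := @pow_n (@matrix_Ring R_Ring 2) M n in
  entry P 0 0 * x + entry P 0 1 * y = l ^ n * x /\
  entry P 1 0 * x + entry P 1 1 * y = l ^ n * y.
Proof.
intros Hx Hy. induction n as [| n [IHx IHy]].
- simpl. unfold coeff_mat. simpl. unfold one, zero. simpl. split; ring.
- set (P := @pow_n (@matrix_Ring R_Ring 2) M n) in *.
  change (@pow_n (@matrix_Ring R_Ring 2) M (S n))
    with (@Mmult R_Ring 2 2 2 M P).
  cbv zeta. rewrite !coeff_mult2 by lia.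
  split.
  + transitivity (entry M 0 0 * (entry P 0 0 * x + entry P 0 1 * y)
                  + entry M 0 1 * (entry P 1 0 * x + entry P 1 1 * y)); [ring |].
    rewrite IHx, IHy. simpl.
    transitivity (l ^ n * (entry M 0 0 * x + entry M 0 1 * y)); [ring |].
    rewrite Hx. ring.
  + transitivity (entry M 1 0 * (entry P 0 0 * x + entry P 0 1 * y)
                  + entry M 1 1 * (entry P 1 0 * x + entry P 1 1 * y)); [ring |].
    rewrite IHx, IHy. simpl.
    transitivity (l ^ n * (entry M 1 0 * x + entry M 1 1 * y)); [ring |].
    rewrite Hy. ring.
Qed.

Lemma eigenvalue_le_opnorm (M : @matrix R 2 2) (l x y B : R) :
  0 < x ^ 2 + y ^ 2 ->
  entry M 0 0 * x + entry M 0 1 * y = l * x ->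
  entry M 1 0 * x + entry M 1 1 * y = l * y ->
  Rbar_le (opnorm M) (Finite B) -> l ^ 2 <= B ^ 2.
Proof.
intros Hpos Hx Hy HB.
set (N := sqrt (x ^ 2 + y ^ 2)).
assert (HN : 0 < N) by now apply sqrt_lt_R0.
assert (EN : N ^ 2 = x ^ 2 + y ^ 2) by (apply pow2_sqrt; lra).
assert (E1 : (x / N) ^ 2 + (y / N) ^ 2 = 1).
{ replace ((x / N) ^ 2 + (y / N) ^ 2) with ((x ^ 2 + y ^ 2) / N ^ 2)
    by (field; lra).
  rewrite EN. field. lra. }
pose proof (opnorm_le_vector M B (x / N) (y / N) HB E1) as H.
replace (entry M 0 0 * (x / N) + entry M 0 1 * (y / N)) with (l * (x / N)) in H.
2: { transitivity ((entry M 0 0 * x + entry M 0 1 * y) / N);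
     [rewrite Hx |]; field; lra. }
replace (entry M 1 0 * (x / N) + entry M 1 1 * (y / N)) with (l * (y / N)) in H.
2: { transitivity ((entry M 1 0 * x + entry M 1 1 * y) / N);
     [rewrite Hy |]; field; lra. }
rewrite !Rpow_mult_distr, <- Rmult_plus_distr_l, E1 in H. lra.
Qed.

(** * Consequences of at most linear growth of the powers *)

(* Bernoulli's inequality at the exponent 3 n already gives cubic growth. *)
Lemma pow_not_quadratically_bounded (q K1 K2 : R) :
  1 < q -> ~ (forall n : nat, q ^ n <= (K1 + INR n * K2) ^ 2).
Proof.
intros Hq H.
set (e := q - 1).
assert (He : 0 < e) by (unfold e; lra).
(* For [n >= 1], [Rabs (K1 + 3 * n * K2)] is at most [n * (Rabs K1 + 3 * Rabs K2)]. *)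
set (C := (Rabs K1 + 3 * Rabs K2) ^ 2).
assert (HC : 0 <= C) by apply pow2_ge_0.
(* The summand 1 secures [n >= 1]; the rest makes the cubic [(n * e) ^ 3] exceed [C * n ^ 2]. *)
destruct (INR_unbounded (C / e ^ 3 + 1)) as [n Hn].
assert (Hc : 0 <= C / e ^ 3).
{ apply Rdiv_le_0_compat; auto. apply pow_lt; auto. }
assert (lower : (INR n * e) ^ 3 <= q ^ (n * 3)).
{ rewrite pow_mult. apply pow_incr. split; [apply Rmult_le_pos; lra |].
  pose proof (poly n e He) as Hb.
  replace (1 + e) with q in Hb by (unfold e; ring). lra. }
assert (upper : (K1 + INR (n * 3) * K2) ^ 2 <= C * INR n ^ 2).
{ unfold C. rewrite <- Rpow_mult_distr. rewrite <- (pow2_abs (K1 + _)).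
  apply pow_incr. split; [apply Rabs_pos |].
  rewrite mult_INR. change (INR 3) with (2 + 1).
  eapply Rle_trans; [apply Rabs_triang |].
  rewrite !Rabs_mult, (Rabs_pos_eq (INR n)), (Rabs_pos_eq (2 + 1)) by lra.
  pose proof (Rabs_pos K1). nra. }
specialize (H (n * 3)%nat).
assert (F : (INR n * e) ^ 3 <= C * INR n ^ 2) by lra.
assert (G : C < INR n * e ^ 3).
{ apply Rlt_div_l; [apply pow_lt; auto | lra]. }
assert (0 < INR n ^ 2) by (apply pow_lt; lra).
replace ((INR n * e) ^ 3) with (INR n * e ^ 3 * INR n ^ 2) in F by ring.
nra.
Qed.

Section PowerGrowth.

Variables (M : @matrix R 2 2) (K1 K2 : R).
Hypothesis HM : forall n : nat,
  Rbar_le (opnorm (@pow_n (@matrix_Ring R_Ring 2) M n)) (Finite (K1 + INR n * K2)).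

(** The powers of the determinant are the determinants of the powers, which grow at most like the
    squared norm, that is quadratically. *)
Lemma det2_le_1 : Rabs (det2 M) <= 1.
Proof.
apply Rnot_lt_le. intro H.
apply (pow_not_quadratically_bounded _ K1 K2 H). intro n.
rewrite RPow_abs, <- det2_pow. now apply det2_le_opnorm.
Qed.

(** An eigenvector of [M] for [l] is one of the [n]-th power for [l ^ n], so
    [(l ^ 2) ^ n = (l ^ n) ^ 2] is bounded by the squared norm. *)
Lemma eigenvalue_le_1 (l x y : R) :
  0 < x ^ 2 + y ^ 2 ->
  entry M 0 0 * x + entry M 0 1 * y = l * x ->
  entry M 1 0 * x + entry M 1 1 * y = l * y ->
  l ^ 2 <= 1.
Proof.
intros Hpos Hx Hy. apply Rnot_lt_le. intro H.
apply (pow_not_quadratically_bounded _ K1 K2 H). intro n.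
rewrite <- pow_mult, Nat.mul_comm, pow_mult.
destruct (pow_n_eigenvector M l x y n Hx Hy) as [Px Py].
exact (eigenvalue_le_opnorm _ _ x y _ Hpos Px Py (HM n)).
Qed.

End PowerGrowth.

(* If the characteristic polynomial [l^2 - a l + q] is negative at [-1], its
   smaller root is an eigenvalue below [-1]. *)
Lemma companion_char_poly_ge_0 (a q K1 K2 : R) :
  (forall n : nat, Rbar_le
     (opnorm (@pow_n (@matrix_Ring R_Ring 2) (mat2 a (- q) 1 0) n))
     (Finite (K1 + INR n * K2))) ->
  0 <= 1 + a + q.
Proof.
intro H. apply Rnot_lt_le. intro Hneg.
(* The difference of the two sides is [4 * (1 + a + q)]. This makes the discriminant positive and
   its root larger than [a + 2], which puts the smaller root below -1. *)
assert (Hd : (a + 2) ^ 2 < a ^ 2 - 4 * q) by nra.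
set (s := sqrt (a ^ 2 - 4 * q)).
assert (Es : s ^ 2 = a ^ 2 - 4 * q) 
  by (apply pow2_sqrt; pose proof (pow2_ge_0 (a + 2)); lra).
assert (Hs : 0 <= s) by apply sqrt_pos.
set (l := (a - s) / 2).
assert (Hl : l < -1).
{ assert (a + 2 < s); [| unfold l; lra].
  apply Rnot_le_lt. intro G. assert (s ^ 2 <= (a + 2) ^ 2); [| lra].
  apply pow_incr. lra. }
assert (El : a * l + - q * 1 = l * l).
{ unfold l. replace q with ((a ^ 2 - s ^ 2) / 4) by lra. field. }
assert (l ^ 2 <= 1).
{ apply (eigenvalue_le_1 _ K1 K2 H l l 1).
  - pose proof (pow2_ge_0 l). lra.
  - exact El.
  - change (1 * l + 0 * 1 = l * 1). ring. }
nra.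
Qed.

(** * The necessary condition for stability *)

(** The determinant bound and the eigenvalue bound are kept apart, so that both the weak and the
    strict inequality can be read off. *)
Lemma stable_necessary (beta gamma m dt dr : R) :
  0 < dt -> 0 < dr ->
  (forall xi : R, khat beta gamma m dt dr xi <> 0) ->
  stable_of_order_n beta gamma m dt dr ->
  0 <= gamma + 4 * beta / dr ^ 2 /\ (dt / dr) ^ 2 <= 1 + m ^ 2 * (dt ^ 2 / 4).
Proof.
intros Ht Hr Hk [K1 [K2 H]].
assert (Hn := fun n => H n PI). specialize (Hk PI).
unfold amplification in Hn.
assert (Hdr : 0 < dr ^ 2) by now apply pow_lt.
assert (Hm : 0 <= m ^ 2 * (dt ^ 2 / 2)).
{ apply Rmult_le_pos; [apply pow2_ge_0 |]. pose proof (pow2_ge_0 dt). lra. }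
assert (Esum : hhat beta gamma m dt dr PI
               = 2 + m ^ 2 * dt ^ 2 - khat beta gamma m dt dr PI).
{ unfold hhat, khat. field. lra. }
assert (Ediff : hhat beta gamma m dt dr PI = khat beta gamma m dt dr PI
                - dt * (gamma + 4 * beta / dr ^ 2)).
{ unfold hhat, khat. rewrite sin_PI2. field. lra. }
rewrite sin_PI2 in Hn.
set (k := khat beta gamma m dt dr PI) in *.
set (h := hhat beta gamma m dt dr PI) in *.
pose proof (companion_char_poly_ge_0 _ _ K1 K2 Hn) as Hchar.
pose proof (det2_le_1 _ K1 K2 Hn) as Hdet.
match type of Hdet with Rabs (det2 (mat2 ?x ?y ?z ?w)) <= 1 =>
  change (Rabs (x * w - y * z) <= 1) in Hdet end.
replace (_ * 0 - - (h / k) * 1) with (h / k) in Hdet by ring.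
apply Rabs_le_between in Hdet.
assert (Eq : h = h / k * k) by (field; auto).
(* The sum [k + h = k * (1 + h / k)] is at least 2, and [1 + h / k] is nonnegative. *)
assert (kpos : 0 < k) by nra.
split.
- apply Rnot_lt_le. intro G. nra.
(* Clearing the positive denominator [k] and inserting [k + h = 2 + m ^ 2 * dt ^ 2] turns the value
   at -1 into the bound on [S]. *)
- replace (1 + 2 / k * (1 - 2 * (dt / dr) ^ 2 * 1 ^ 2) + h / k)
    with ((k + h + 2 - 4 * (dt / dr) ^ 2) / k) in Hchar by (field; lra).
  set (S := (dt / dr) ^ 2) in *.
  assert (E : k + h + 2 - 4 * S = (k + h + 2 - 4 * S) / k * k) by (field; auto).
  assert (0 <= k + h + 2 - 4 * S) by (rewrite E; apply Rmult_le_pos; lra).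
  lra.
Qed.

Theorem mainTheorem2 (beta gamma m : R) :
  consistent_order_2_2 beta gamma m
  /\
  forall dt dr : R,
  0 < dt -> 0 < dr ->
  (forall xi : R, khat beta gamma m dt dr xi <> 0) ->
  stable_of_order_n beta gamma m dt dr ->
  (dt / dr) ^ 2
    <= 1 + gamma * (dt / 4) + beta * (dt / dr ^ 2) + m ^ 2 * (dt ^ 2 / 4)
  /\
  (gamma + 4 * beta / dr ^ 2 <> 0 ->
   (dt / dr) ^ 2
     < 1 + gamma * (dt / 4) + beta * (dt / dr ^ 2) + m ^ 2 * (dt ^ 2 / 4)).
Proof.
split; [apply scheme_consistent |].
intros dt dr Ht Hr Hk Hs.
destruct (stable_necessary beta gamma m dt dr Ht Hr Hk Hs) as [Hd HR].
(* The right-hand side is the bound on the squared step ratio plus a positive multiple of the total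
   damping at [PI], which is nonnegative; nonzero damping gives strictness. *)
replace (1 + gamma * (dt / 4) + beta * (dt / dr ^ 2) + m ^ 2 * (dt ^ 2 / 4))
  with (1 + m ^ 2 * (dt ^ 2 / 4) + dt / 4 * (gamma + 4 * beta / dr ^ 2))
  by (field; lra).
split; [| intro Hne]; nra.
Qed.
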